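(* Let $\Omega\subset\mathbb{R}^n$ be a proper convex domain. If $x$, $y$ and $z$ are three points in $\Omega$, then the triangle inequality $$F_\Omega(x,y)+F_\Omega(y,z)\ \ge\ F_\Omega(x,z)$$ holds. Furthermore, we have equality $F_\Omega(x,y)+F_\Omega(y,z)=F_\Omega(x,z)$ if and only if the three points $a_\Omega(x,y),\ a_\Omega(y,z),\ a_\Omega(x,z)\in\tilde\partial\Omega$ are aligned in $\mathbb{RP}^n$.
   Context: A proper convex domain in $\mathbb{R}^n$ is a non-empty open convex subset $\Omega\neq\mathbb{R}^n$. View $\mathbb{R}^n$ as an affine space in $\mathbb{RP}^n$ with hyperplane at infinity $H_\infty=\mathbb{RP}^n\setminus\mathbb{R}^n$; $\widetilde\Omega$ is the closure of $\Omega$ in $\mathbb{RP}^n$ and $\tilde\partial\Omega=\widetilde\Omega\setminus\Omega$. For $x\ne y$ in $\Omega$ let $R(x,y)=\{x+t(y-x): t\ge 0\}$ and let $\tilde R(x,y)$ be its closure in $\mathbb{RP}^n$. Set $a_\Omega(x,y)=\tilde R(x,y)\cap\tilde\partial\Omega\in\mathbb{RP}^n$, understood as a single point: the point of $R(x,y)\cap\partial\Omega$ if $R(x,y)\not\subset\Omega$, and the point at infinity of $R(x,y)$ if $R(x,y)\subset\Omega$. The Funk metric is $F_\Omega(x,x)=0$ and, for $x\neq y$ and $a=a_\Omega(x,y)$, $F_\Omega(x,y)=\log\frac{|x-a|}{|y-a|}$ (Euclidean distances) if $a\notin H_\infty$, and $F_\Omega(x,y)=0$ if $a\in H_\infty$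.
   Formalization: The equality criterion is stated for pairwise distinct x, y, z and, when they are collinear, only if y lies in the segment [x,z] or Ω contains the whole line; for other collinear triples the three points are aligned but the inequality is strict, so the printed criterion fails. *)

(* Defs.v *)
From HB Require Import structures.
From mathcomp Require Import all_boot all_order all_algebra.
From mathcomp Require Import all_classical all_reals all_analysis.
Set Implicit Arguments.
Unset Strict Implicit.
Unset Printing Implicit Defensive.
Import Order.TTheory GRing.Theory Num.Theory numFieldNormedType.Exports.
Local Open Scope classical_set_scope.
Local Open Scope ring_scope.

(** * Real projective space *)

(* RP^n as the set of lines through the origin of R^(1+n). *)
Record RP (R : realType) (n : nat) : Type := MkRP {
  RP_line : {vspace 'rV[R]_(1 + n)};
  RP_dim : \dim RP_line == 1%N }.
HB.instance Definition _ (R : realType) (n : nat) := [isSub for @RP_line R n].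
HB.instance Definition _ (R : realType) (n : nat) := [Choice of RP R n by <:].

Lemma affine_coord_neq0 (R : realType) (n : nat) (p : 'rV[R]_n) :
  row_mx 1%:M p != 0 :> 'rV[R]_(1 + n).
Proof.
apply/eqP => /matrixP /(_ 0 (lshift n 0)) /eqP.
by rewrite row_mxEl !mxE /= oner_eq0.
Qed.

Lemma RP_base_subproof (R : realType) (n : nat) :
  \dim <[row_mx 1%:M 0 : 'rV[R]_(1 + n)]>%VS == 1%N.
Proof. by rewrite dim_vline affine_coord_neq0. Qed.

(* The point with homogeneous coordinates w. For w = 0, which represents no
   point, the value is the arbitrary base point [1 : 0 : ... : 0]. *)
Definition RP_of (R : realType) (n : nat) (w : 'rV[R]_(1 + n)) : RP R n :=
  insubd (MkRP (RP_base_subproof R n)) <[w]>%VS.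

Definition affine_point (R : realType) (n : nat) (p : 'rV[R]_n) : RP R n :=
  RP_of (row_mx 1%:M p).

(* The common point at infinity of the affine lines of direction v <> 0. *)
Definition infinity_point (R : realType) (n : nat) (v : 'rV[R]_n) : RP R n :=
  RP_of (row_mx 0 v).

Definition hyperplane_at_infinity (R : realType) (n : nat) : set (RP R n) :=
  ~` range (@affine_point R n).

(* Inverse of affine_point outside the hyperplane at infinity. *)
Definition affine_part (R : realType) (n : nat) (a : RP R n) : 'rV[R]_n :=
  get [set p | affine_point p = a].

(* A projective line is a plane through the origin of R^(1+n). *)
Definition aligned (R : realType) (n : nat) (a b c : RP R n) : Prop :=
  exists L : {vspace 'rV[R]_(1 + n)},
    [/\ \dim L = 2%N, (RP_line a <= L)%VS, (RP_line b <= L)%VS & (RP_line c <= L)%VS].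

(** * Euclidean and convex geometry of R^n *)

(* The library norm on 'rV[R]_n is the sup norm; it induces the usual topology
   but not the Euclidean distance. *)
Definition edist (R : realType) (n : nat) (x y : 'rV[R]_n) : R :=
  Num.sqrt (\sum_(i < n) (x 0 i - y 0 i) ^+ 2).

Definition proper_convex_domain (R : realType) (n : nat)
    (Om : set 'rV[R]_n) : Prop :=
  [/\ Om !=set0, open Om, @convex_set R 'rV[R]_n Om & Om <> setT].

Definition ray (R : realType) (n : nat) (x y : 'rV[R]_n) : set 'rV[R]_n :=
  [set x + t *: (y - x) | t in [set t : R | 0 <= t]].

Definition segment (R : realType) (n : nat) (x y : 'rV[R]_n) : set 'rV[R]_n :=
  [set x + t *: (y - x) | t in [set t : R | 0 <= t <= 1]].

Definition line (R : realType) (n : nat) (x y : 'rV[R]_n) : set 'rV[R]_n :=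
  [set x + t *: (y - x) | t in [set: R]].

Definition boundary (R : realType) (n : nat)
    (Om : set 'rV[R]_n) : set 'rV[R]_n :=
  closure Om `\` interior Om.

(** * The Funk metric *)

(* The point a_Om(x, y); meaningful for x <> y in Om. *)
Definition funk_point (R : realType) (n : nat) (Om : set 'rV[R]_n)
    (x y : 'rV[R]_n) : RP R n :=
  if `[< ray x y `<=` Om >] then infinity_point (y - x)
  else affine_point (get (ray x y `&` boundary Om)).

Definition funk (R : realType) (n : nat) (Om : set 'rV[R]_n)
    (x y : 'rV[R]_n) : R :=
  if x == y then 0 else
  let a := funk_point Om x y in
  if `[< hyperplane_at_infinity a >] then 0
  else ln (edist x (affine_part a) / edist y (affine_part a)).

(* Main.v *)
Require Import Defs.
From HB Require Import structures.
From mathcomp Require Import all_boot all_order all_algebra.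
From mathcomp Require Import all_classical all_reals all_analysis.
From mathcomp Require Import ring lra.
Import Order.TTheory GRing.Theory Num.Theory numFieldNormedType.Exports.
Local Open Scope classical_set_scope.
Local Open Scope ring_scope.

(** Work in homogeneous coordinates: [X], [Y], [Z] are the vectors [(1, x)],
[(1, y)], [(1, z)] and [C] is the open convex cone over [Om]. For [x], [y] in
[Om] there is a unique [m] in ]0, 1] such that

  [Y - mu X] lies in [C] if and only if [mu < m].

Indeed [Y - mu X] represents the point of parameter [1 / (1 - mu)] of the ray
from [x] through [y]. If the ray leaves [Om] at parameter [tau] then
[m = 1 - 1 / tau], and if it never does then [m = 1]. In both cases
[funk Om x y = - ln m], and [Y - m X] spans the line of the projective point
[funk_point Om x y] (lemma [funkP]).

Let [m1], [m2], [m3] be the numbers attached to [(x, y)], [(y, z)], [(x, z)].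
From [Z - mu1 mu2 X = (Z - mu2 Y) + mu2 (Y - mu1 X)] and the convexity of [C]
one gets [m1 m2 <= m3] (lemma [cut_super_mul]), which is the triangle
inequality, and equality holds exactly when [m3 = m1 m2].

If [m3 = m1 m2] the same identity shows that the three vectors [Y - m1 X],
[Z - m2 Y], [Z - m3 X] are linearly dependent, so the points are aligned (lemma
[aligned_of_mul]). Conversely, in a plane containing these three vectors one
finds [(m1 m2 - m3) X]; were that coefficient nonzero, the plane would contain
[X], then [Y], then [Z], which are independent unless [x], [y], [z] are
collinear (lemma [mul_of_aligned]). In the collinear case, either [y] is between
[x] and [z] and [m1], [m2] are explicit functions of [m3] whose product is [m3]
(lemma [cut_mul_between]), or [Om] contains the line and all three numbers are
[1] (lemma [cut_eq1]). *)

(** * Homogeneous coordinates *)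

(** The vector [(1, p)] of homogeneous coordinates of the affine point [p]. *)
Definition homog {R : realType} {n : nat} (p : 'rV[R]_n) : 'rV[R]_(1 + n) :=
  row_mx 1%:M p.

Lemma homog_neq0 {R : realType} {n : nat} (p : 'rV[R]_n) : homog p != 0.
Proof. exact: affine_coord_neq0. Qed.

Lemma homog_combE {R : realType} {n : nat} (a b : R) (p q : 'rV[R]_n) :
  a *: homog p + b *: homog q = row_mx (a + b)%:M (a *: p + b *: q).
Proof.
by rewrite /homog !scale_row_mx add_row_mx !scale_scalar_mx !mulr1 -raddfD.
Qed.

Lemma scale_homogE {R : realType} {n : nat} (a : R) (p : 'rV[R]_n) :
  a *: homog p = row_mx a%:M (a *: p).
Proof. by rewrite /homog scale_row_mx scale_scalar_mx mulr1. Qed.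

Lemma eq_row_mx_scalar {R : realType} {n : nat} (a b : R) (u v : 'rV[R]_n) :
  row_mx a%:M u = row_mx b%:M v :> 'rV[R]_(1 + n) -> a = b /\ u = v.
Proof.
move=> /eq_row_mx[/matrixP/(_ 0 0)]; rewrite !mxE eqxx !mulr1n => -> ->.
by [].
Qed.

Lemma homog_line {R : realType} {n : nat} (t : R) (x z : 'rV[R]_n) :
  homog (x + t *: (z - x)) = (1 - t) *: homog x + t *: homog z.
Proof.
rewrite homog_combE subrK; congr row_mx.
by rewrite scalerBr scalerBl scale1r addrCA addrC.
Qed.

Lemma RP_line_of {R : realType} {n : nat} (w : 'rV[R]_(1 + n)) :
  w != 0 -> RP_line (RP_of w) = <[w]>%VS.
Proof.
move=> w0; rewrite /RP_of.
by rewrite -[LHS]/(\val (insubd _ _)) insubdK// unfold_in /= dim_vline w0.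
Qed.

Lemma vline_scale {R : realType} {n : nat} (k : R) (w : 'rV[R]_n) :
  k != 0 -> <[k *: w]>%VS = <[w]>%VS.
Proof.
move=> k0; apply/eqP; rewrite eqEsubv -!memvE; apply/andP; split.
  by rewrite memvZ ?memv_line.
by apply/vlineP; exists k^-1; rewrite scalerA mulVf ?scale1r.
Qed.

Lemma affine_point_inj {R : realType} {n : nat} : injective (@affine_point R n).
Proof.
move=> p q /(congr1 (@RP_line R n)).
rewrite !RP_line_of ?affine_coord_neq0// => pq.
have /vlineP[k] : homog p \in <[homog q]>%VS by rewrite -pq memv_line.
by rewrite scale_homogE => /eq_row_mx_scalar[<- ->]; rewrite scale1r.
Qed.

Lemma affine_pointK {R : realType} {n : nat} (p : 'rV[R]_n) :
  affine_part (affine_point p) = p.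
Proof.
apply: affine_point_inj; rewrite /affine_part.
by apply: (@getPex _ [set q | affine_point q = affine_point p]); exists p.
Qed.

Lemma affine_point_not_infinity {R : realType} {n : nat} (p : 'rV[R]_n) :
  ~ hyperplane_at_infinity (affine_point p).
Proof. by apply; exists p. Qed.

Lemma infinity_point_at_infinity {R : realType} {n : nat} (v : 'rV[R]_n) :
  v != 0 -> hyperplane_at_infinity (infinity_point v).
Proof.
move=> v0 [p _] /(congr1 (@RP_line R n)).
have w0 : row_mx 0 v != 0 :> 'rV[R]_(1 + n).
  by apply: contra_neq v0; rewrite -row_mx0 => /eq_row_mx[].
rewrite !RP_line_of ?affine_coord_neq0// => pq.
have /vlineP[k] : homog p \in <[row_mx 0 v : 'rV[R]_(1 + n)]>%VS.
  by rewrite -pq memv_line.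
have -> : 0 = 0%:M :> 'M[R]_1 by rewrite raddf0.
rewrite scale_row_mx scale_scalar_mx mulr0 => /eq_row_mx_scalar[/eqP].
by rewrite oner_eq0.
Qed.

(** * Euclidean distance *)

Lemma edist_scale {R : realType} {n : nat} (k : R) (p q p' q' : 'rV[R]_n) :
  p - q = k *: (p' - q') -> Defs.edist p q = `|k| * Defs.edist p' q'.
Proof.
move=> pq; rewrite /Defs.edist -sqrtr_sqr -sqrtrM ?sqr_ge0// mulr_sumr.
congr Num.sqrt; apply: eq_bigr => i _.
by have /rowP/(_ i) := pq; rewrite !mxE => ->; rewrite exprMn.
Qed.

Lemma edist_gt0 {R : realType} {n : nat} (p q : 'rV[R]_n) :
  p != q -> 0 < Defs.edist p q.
Proof.
move=> pq; rewrite sqrtr_gt0 lt_neqAle sumr_ge0 ?andbT; last first.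
  by move=> i _; rewrite sqr_ge0.
rewrite eq_sym; apply: contra_neq pq => /eqP.
rewrite psumr_eq0; last by move=> i _; rewrite sqr_ge0.
move=> /allP pq; apply/rowP => i.
have /= := pq i (mem_index_enum i).
by rewrite sqrf_eq0 subr_eq0 => /eqP.
Qed.

(** * Rays in an open convex set *)

Lemma convex_comb {R : realType} {n : nat} (Om : set 'rV[R]_n) (t : R)
    (p q : 'rV[R]_n) :
  @convex_set R 'rV[R]_n Om -> 0 <= t <= 1 -> Om p -> Om q ->
  Om (t *: p + (1 - t) *: q).
Proof.
move=> cOm t01 Omp Omq.
have := cOm p q (Itv01 (proj1 (andP t01)) (proj2 (andP t01))).
by rewrite !inE; apply.
Qed.

(** The half-open segment from a point of an open convex set to a point of its
    closure lies in the set. *)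
Lemma open_segment_closure {R : realType} {n : nat} (Om : set 'rV[R]_n) (l : R)
    (x b : 'rV[R]_n) :
  open Om -> @convex_set R 'rV[R]_n Om -> Om x -> closure Om b -> 0 <= l < 1 ->
  Om (x + l *: (b - x)).
Proof.
move=> oOm cOm Omx clb /andP[l0 l1].
have l1' : 1 - l != 0 by rewrite subr_eq0 gt_eqF.
(* [c] is a convex combination of [p] and [f p]; since [f b = x] is interior,
   [f p] is in [Om] for [p] in [Om] close enough to [b]. *)
set c := x + l *: (b - x).
pose f (p : 'rV[R]_n) := (1 - l)^-1 *: (c - l *: p).
have fb : f b = x by apply/rowP => i; rewrite !mxE; field.
have fc : f p @[p --> b] --> f b.
  have lp : l *: p @[p --> b] --> l *: b by exact: (cvgZ (cvg_cst l) cvg_id).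
  have clp : c - l *: p @[p --> b] --> c - l *: b by exact: (cvgB (cvg_cst c) lp).
  exact: (cvgZ (cvg_cst (1 - l)^-1) clp).
have nb : nbhs b (f @^-1` Om).
  by apply: fc; rewrite fb; apply: open_nbhs_nbhs.
have [p [Omp Omfp]] := clb _ nb.
have -> : c = l *: p + (1 - l) *: f p.
  by rewrite scalerA mulfV// scale1r addrCA subrr addr0.
by apply: convex_comb => //; rewrite l0 ltW.
Qed.

Lemma cvg_line {R : realType} {n : nat} (x v : 'rV[R]_n) (t : R) :
  x + s *: v @[s --> t] --> x + t *: v.
Proof. by apply: cvgD; [exact: cvg_cst|apply: cvgZr_tmp; exact: cvg_id]. Qed.

(** A ray that leaves an open convex set does so at one parameter [tau], and it
    meets the boundary only there. *)
Lemma ray_exit {R : realType} {n : nat} (Om : set 'rV[R]_n) (x y : 'rV[R]_n) :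
  open Om -> @convex_set R 'rV[R]_n Om -> Om x -> Om y -> ~ ray x y `<=` Om ->
  exists tau, [/\ 1 < tau,
    forall t, 0 <= t -> Om (x + t *: (y - x)) <-> t < tau &
    ray x y `&` boundary Om = [set x + tau *: (y - x)]].
Proof.
move=> oOm cOm Omx Omy nray; set v := y - x.
have down (s t : R) : 0 <= s <= t -> Om (x + t *: v) -> Om (x + s *: v).
  move=> /andP[s0 st] Omt.
  have [t0|t0] := eqVneq t 0.
    by have -> : s = t by apply/eqP; rewrite eq_le st t0.
  have tp : 0 < t by rewrite lt_neqAle eq_sym t0 (le_trans s0).
  have -> : x + s *: v = (s / t) *: (x + t *: v) + (1 - s / t) *: x.
    by apply/rowP => i; rewrite !mxE; field.
  by apply: convex_comb => //; rewrite divr_ge0 ?(ltW tp)//= ler_pdivrMr// mul1r.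
have [t1 [t1_ge0 nOmt1]] : exists t, 0 <= t /\ ~ Om (x + t *: v).
  have /existsNP[p /not_implyP[[t /= t0 <-] nOm]] := nray.
  by exists t.
pose T := [set t : R | 0 <= t /\ Om (x + t *: v)].
have T1 : T 1 by split; rewrite // scale1r addrC subrK.
have Tub : has_ubound T.
  exists t1 => t [t0 Omt]; rewrite leNgt; apply/negP => t1t.
  by apply: nOmt1; apply: down Omt; rewrite t1_ge0 ltW.
set tau := sup T.
have OmP t : 0 <= t -> Om (x + t *: v) <-> t < tau.
  move=> t0; split=> [Omt|/(sup_gt (ex_intro _ _ T1))[s [s0 Oms] ts]]; last first.
    by apply: down Oms; rewrite t0 ltW.
  have : \forall s \near t, Om (x + s *: v).
    by apply: (cvg_line x v t); apply: open_nbhs_nbhs.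
  move=> /nbhs_ballP[e /= e0]; rewrite /ball/= => eOm.
  have te : Om (x + (t + e / 2) *: v).
    by apply: eOm; rewrite opprD addrA subrr sub0r normrN gtr0_norm; lra.
  have : t + e / 2 <= tau by apply: ub_le_sup => //; split=> //; lra.
  lra.
have tau1 : 1 < tau by apply/(OmP 1 ler01); case: T1.
have tau0 : 0 <= tau by rewrite (le_trans ler01)// ltW.
have cltau : closure Om (x + tau *: v).
  move=> B /(cvg_line x v tau) /= nB.
  have [t [[_ Omt] Bt]] := closure_sup (ex_intro _ _ T1) Tub nB.
  by exists (x + t *: v).
have intOm : interior Om = Om by apply/interior_id.
exists tau; split=> //; rewrite /boundary intOm.
apply/seteqP; split=> [p [[t /= t0 <-] [clt nOmt]]|p ->]; last first.
  split; first by exists tau.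
  by split=> // /(OmP tau tau0); rewrite ltxx.
have : tau <= t by rewrite leNgt; apply/negP => /(OmP t t0).
rewrite le_eqVlt => /predU1P[->//|taut].
(* A boundary point beyond [tau] would put the point of parameter [tau] in [Om]. *)
suff /(OmP tau tau0) : Om (x + tau *: v) by rewrite ltxx.
have tp : 0 < t by lra.
have -> : x + tau *: v = x + (tau / t) *: ((x + t *: v) - x).
  by apply/rowP => i; rewrite !mxE; field; lra.
apply: open_segment_closure => //.
by rewrite divr_ge0 ?(ltW tp)//= ltr_pdivrMr// mul1r.
Qed.

(** * The cone over a convex set *)

(** The cone, in homogeneous coordinates, over the set [Om] of affine points. *)
Definition homog_cone {R : realType} {n : nat} (Om : set 'rV[R]_n) :
    set 'rV[R]_(1 + n) :=
  [set w | exists l p, [/\ 0 < l, Om p & w = l *: homog p]].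

Lemma homog_cone_scale {R : realType} {n : nat} (Om : set 'rV[R]_n) (k : R)
    (w : 'rV[R]_(1 + n)) :
  0 < k -> homog_cone Om (k *: w) <-> homog_cone Om w.
Proof.
move=> k0.
have up (k' : R) w' : 0 < k' -> homog_cone Om w' -> homog_cone Om (k' *: w').
  move=> k'0 [l [p [l0 Omp ->]]]; exists (k' * l), p.
  by rewrite mulr_gt0// scalerA.
split=> [kw|]; last exact: up.
have -> : w = k^-1 *: (k *: w) by rewrite scalerA mulVf ?scale1r// gt_eqF.
by apply: up; rewrite ?invr_gt0.
Qed.

Lemma homog_coneD {R : realType} {n : nat} (Om : set 'rV[R]_n)
    (u w : 'rV[R]_(1 + n)) :
  @convex_set R 'rV[R]_n Om -> homog_cone Om u -> homog_cone Om w ->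
  homog_cone Om (u + w).
Proof.
move=> cOm [l [p [l0 Omp ->]]] [k [q [k0 Omq ->]]].
have lk : 0 < l + k by exact: addr_gt0.
exists (l + k), ((l / (l + k)) *: p + (1 - l / (l + k)) *: q); split=> //.
  apply: convex_comb => //.
  by rewrite ler_pdivrMr// mul1r lerDl (ltW k0) divr_ge0 ?(ltW l0) ?(ltW lk).
rewrite homog_combE scale_homogE; congr row_mx.
by apply/rowP => i; rewrite !mxE; field; rewrite gt_eqF.
Qed.

(** The vector [homog y - mu *: homog x] represents the point of the ray from
    [x] through [y] of parameter [(1 - mu)^-1]. *)
Lemma homog_cone_subP {R : realType} {n : nat} (Om : set 'rV[R]_n) (mu : R)
    (x y : 'rV[R]_n) :
  homog_cone Om (homog y - mu *: homog x) <->
  mu < 1 /\ Om (x + (1 - mu)^-1 *: (y - x)).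
Proof.
have E : homog y - mu *: homog x = row_mx (1 - mu)%:M (y - mu *: x).
  by rewrite -[X in X - _]scale1r -scaleNr homog_combE scale1r scaleNr.
split=> [[l [p [l0 Omp]]]|[mu1 Omp]].
  rewrite E scale_homogE => /eq_row_mx_scalar[lE pE].
  have mu1 : mu < 1 by rewrite -subr_gt0 lE.
  split=> //; suff -> : x + (1 - mu)^-1 *: (y - x) = p by [].
  have := congr1 (fun w => (1 - mu)^-1 *: w) pE.
  rewrite -lE scalerA mulVf ?scale1r; last by rewrite subr_eq0 gt_eqF.
  by move=> <-; apply/rowP => i; rewrite !mxE; field; rewrite subr_eq0 gt_eqF.
exists (1 - mu), (x + (1 - mu)^-1 *: (y - x)); split; rewrite ?subr_gt0//.
rewrite E scale_homogE; congr row_mx.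
by apply/rowP => i; rewrite !mxE; field; rewrite subr_eq0 gt_eqF.
Qed.

(** * The Funk metric in terms of the cone *)

(** Both the Funk metric and the point [funk_point] are read off from the
    threshold [m] at which [homog y - mu *: homog x] leaves the cone. The
    statement includes [x = y], with [m = 1], except for the last clause, which
    concerns a point defined only for distinct [x] and [y]. *)
Lemma funkP {R : realType} {n : nat} (Om : set 'rV[R]_n) (x y : 'rV[R]_n) :
  proper_convex_domain Om -> Om x -> Om y ->
  exists m, [/\ 0 < m, m <= 1, funk Om x y = - ln m,
    forall mu, homog_cone Om (homog y - mu *: homog x) <-> mu < m &
    x != y -> RP_line (funk_point Om x y) = <[homog y - m *: homog x]>%VS].
Proof.
move=> [_ oOm cOm _] Omx Omy; rewrite /funk.
have [<-|xy] := eqVneq x y.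
  exists 1; rewrite ln1 oppr0; split=> // mu; rewrite homog_cone_subP subrr.
  by rewrite scaler0 addr0; split=> [[]|].
have yx0 : y - x != 0 by rewrite subr_eq0 eq_sym.
rewrite /funk_point; case: (asboolP (ray x y `<=` Om)) => [ray_in|ray_out].
  exists 1; rewrite asboolT; last exact: infinity_point_at_infinity.
  rewrite ln1 oppr0; split=> // [mu|_].
    rewrite homog_cone_subP; split=> [[]//|mu1]; split=> //.
    by apply: ray_in; exists (1 - mu)^-1 => //=; rewrite invr_ge0 subr_ge0 ltW.
  have -> : homog y - 1 *: homog x = row_mx 0 (y - x).
    by rewrite scale1r /homog opp_row_mx add_row_mx subrr.
  rewrite RP_line_of//.
  by apply: contra_neq yx0; rewrite -row_mx0 => /eq_row_mx[].
have [tau [tau1 OmP exitE]] := ray_exit _ _ _ oOm cOm Omx Omy ray_out.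
set a := x + tau *: (y - x).
have -> : get (ray x y `&` boundary Om) = a.
  by rewrite exitE; apply: (@getPex _ [set a]); exists a.
rewrite asboolF; last exact: affine_point_not_infinity.
have tau0 : 0 < tau by lra.
have m0 : 0 < 1 - tau^-1 by rewrite subr_gt0 invf_lt1.
exists (1 - tau^-1); split=> // [|||_].
- by rewrite lerBlDr lerDl invr_ge0 ltW.
- rewrite affine_pointK -lnV ?posrE//; congr ln.
  have -> : Defs.edist x a = `|tau| * Defs.edist x y.
    by apply: edist_scale; apply/rowP => i; rewrite !mxE; ring.
  have -> : Defs.edist y a = `|tau - 1| * Defs.edist x y.
    by apply: edist_scale; apply/rowP => i; rewrite !mxE; ring.
  rewrite !gtr0_norm; [|lra|lra].
  have := edist_gt0 _ _ xy; move: (Defs.edist x y) => d d0.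
  by field; apply/and3P; split; lra.
- move=> mu; rewrite homog_cone_subP.
  split=> [[mu1 /OmP]|mu1].
    rewrite invr_ge0 subr_ge0 (ltW mu1) => /(_ isT).
    by rewrite invf_plt ?posrE ?subr_gt0//; lra.
  have mu1' : mu < 1 by rewrite (lt_trans mu1)// ltrBlDr ltrDl invr_gt0.
  split=> //; apply/OmP; first by rewrite invr_ge0 subr_ge0 ltW.
  by rewrite invf_plt ?posrE ?subr_gt0//; lra.
- rewrite RP_line_of ?affine_coord_neq0//.
  have -> : homog y - (1 - tau^-1) *: homog x = tau^-1 *: homog a.
    rewrite /a homog_line scalerDr !scalerA mulVf ?gt_eqF// scale1r.
    by rewrite mulrBr mulr1 mulVf ?gt_eqF// addrC -scaleNr opprB.
  by rewrite vline_scale// invr_eq0 gt_eqF.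
Qed.

(** * Alignment of the three boundary points *)

Lemma dim_span2 {K : fieldType} {V : vectType K} (u v : V) :
  v != 0 -> u \notin <[v]>%VS -> \dim <<[:: u; v]>>%VS = 2%N.
Proof.
move=> v0 uv; apply/eqP; rewrite -[_ == _]/(free [:: u; v]) free_cons.
by rewrite span_seq1 uv seq1_free.
Qed.

Lemma homog_line_notin {R : realType} {n : nat} (x y : 'rV[R]_n) :
  x != y -> homog y \notin <[homog x]>%VS.
Proof.
apply: contra_neqN => /vlineP[k].
by rewrite scale_homogE => /eq_row_mx_scalar[<- ->]; rewrite scale1r.
Qed.

Lemma homog_free3 {R : realType} {n : nat} (x y z : 'rV[R]_n) :
  x != z -> ~ line x z y -> free [:: homog y; homog z; homog x].
Proof.
move=> xz nl; rewrite 2!free_cons seq1_free homog_neq0 span_seq1 andbT.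
rewrite homog_line_notin// andbT; apply/negP.
rewrite span_cons span_seq1 => /memv_addP[_ /vlineP[t ->] [_ /vlineP[s ->]]].
rewrite homog_combE => /eq_row_mx_scalar[st yE]; apply: nl.
exists t => //; rewrite yE.
have -> : s = 1 - t by rewrite st addrAC subrr add0r.
by apply/rowP => i; rewrite !mxE; ring.
Qed.

(** If [m3 = m1 * m2] the three representing vectors are linearly dependent. *)
Lemma aligned_of_mul {R : realType} {n : nat} (x y z : 'rV[R]_n) (m1 m2 m3 : R)
    (a b c : RP R n) :
  x != y -> m3 = m1 * m2 ->
  RP_line a = <[homog y - m1 *: homog x]>%VS ->
  RP_line b = <[homog z - m2 *: homog y]>%VS ->
  RP_line c = <[homog z - m3 *: homog x]>%VS ->
  aligned a b c.
Proof.
move=> xy m3E aE bE cE.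
set A := homog y - _ in aE; set B := homog z - _ in bE.
set C := homog z - _ in cE.
have CE : C = B + m2 *: A.
  by rewrite /A /B /C scalerBr scalerA addrA subrK m3E mulrC.
have A0 : A != 0.
  have := homog_line_notin _ _ xy; apply: contraNneq => /eqP.
  by rewrite subr_eq0 => /eqP ->; rewrite memvZ ?memv_line.
have [BA|BA] := boolP (B \in <[A]>%VS); last first.
  pose L := <<[:: B; A]>>%VS.
  have AL : A \in L by rewrite memv_span// !inE eqxx orbT.
  have BL : B \in L by rewrite memv_span// !inE eqxx.
  exists L; rewrite dim_span2// aE bE cE -!memvE AL BL.
  by split=> //; rewrite CE memvD ?memvZ.
(* Otherwise [B] and [C] are multiples of [A], which represents a point of the
   projective line through [x] and [y]. *)
pose L := <<[:: homog y; homog x]>>%VS.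
have AL : A \in L.
  by rewrite memvB ?memvZ// memv_span// !inE eqxx ?orbT.
have BL : B \in L by have /vlineP[k ->] := BA; rewrite memvZ.
exists L; rewrite dim_span2 ?homog_neq0 ?homog_line_notin// aE bE cE -!memvE AL BL.
by split=> //; rewrite CE memvD ?memvZ.
Qed.

(** For non-collinear [x], [y], [z] the vectors of homogeneous coordinates are
    independent, and a plane containing the three representing vectors would
    contain all of them if [m3] were not [m1 * m2]. *)
Lemma mul_of_aligned {R : realType} {n : nat} (x y z : 'rV[R]_n) (m1 m2 m3 : R)
    (a b c : RP R n) :
  x != z -> ~ line x z y ->
  RP_line a = <[homog y - m1 *: homog x]>%VS ->
  RP_line b = <[homog z - m2 *: homog y]>%VS ->
  RP_line c = <[homog z - m3 *: homog x]>%VS ->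
  aligned a b c -> m3 = m1 * m2.
Proof.
move=> xz nl aE bE cE [L [L2]]; rewrite aE bE cE -!memvE => AL BL CL.
apply/eqP; apply: contraT => m3N.
have d0 : m1 * m2 - m3 != 0 by rewrite subr_eq0 eq_sym.
have xL : homog x \in L.
  have : (m1 * m2 - m3) *: homog x \in L.
    have -> : (m1 * m2 - m3) *: homog x = (homog z - m3 *: homog x) -
        (homog z - m2 *: homog y) - m2 *: (homog y - m1 *: homog x).
      by apply/rowP => i; rewrite !mxE; ring.
    by apply: memvB; [exact: memvB|exact: memvZ].
  by move=> /(memvZ (m1 * m2 - m3)^-1); rewrite scalerA mulVf// scale1r.
have yL : homog y \in L by rewrite -(subrK (m1 *: homog x) (homog y)) memvD// memvZ.
have zL : homog z \in L by rewrite -(subrK (m2 *: homog y) (homog z)) memvD// memvZ.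
have : (<<[:: homog y; homog z; homog x]>> <= L)%VS.
  by apply/span_subvP => w; rewrite !inE => /or3P[] /eqP ->.
have /eqP d3 := homog_free3 _ _ _ xz nl.
by move/dimvS; rewrite d3 L2.
Qed.

(** * Comparison of the thresholds *)

Lemma lt_cut_inj {R : realFieldType} (a b : R) :
  (forall mu, mu < a <-> mu < b) -> a = b.
Proof.
move=> ab; apply/eqP; rewrite eq_le !leNgt.
by apply/andP; split; apply/negP => /ab; rewrite ltxx.
Qed.

(** The multiplicative form of the triangle inequality. *)
Lemma cut_super_mul {R : realType} {n : nat} (Om : set 'rV[R]_n)
    (x y z : 'rV[R]_n) (m1 m2 m3 : R) :
  @convex_set R 'rV[R]_n Om -> 0 < m1 -> 0 < m2 -> 0 < m3 ->
  (forall mu, homog_cone Om (homog y - mu *: homog x) <-> mu < m1) ->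
  (forall mu, homog_cone Om (homog z - mu *: homog y) <-> mu < m2) ->
  (forall mu, homog_cone Om (homog z - mu *: homog x) <-> mu < m3) ->
  m1 * m2 <= m3.
Proof.
move=> cOm m10 m20 m30 P1 P2 P3; rewrite leNgt; apply/negP => lt3.
(* Midpoints give [mu1 < m1] and [mu2 < m2] with [m3 < mu1 * mu2]. *)
have /midf_lt[lt1 lt1'] : m3 / m2 < m1 by rewrite ltr_pdivrMr.
set mu1 := (_ / 2) in lt1 lt1'.
have mu10 : 0 < mu1 by rewrite (lt_trans _ lt1)// divr_gt0.
have /midf_lt[lt2 lt2'] : m3 / mu1 < m2.
  by rewrite ltr_pdivrMr// mulrC -ltr_pdivrMr.
set mu2 := (_ / 2) in lt2 lt2'.
have mu20 : 0 < mu2 by rewrite (lt_trans _ lt2)// divr_gt0.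
have : homog_cone Om (homog z - (mu1 * mu2) *: homog x).
  have -> : homog z - (mu1 * mu2) *: homog x =
      (homog z - mu2 *: homog y) + mu2 *: (homog y - mu1 *: homog x).
    by rewrite scalerBr scalerA addrA subrK mulrC.
  apply: homog_coneD => //; first exact/P2.
  by apply/homog_cone_scale => //; apply/P1.
by move=> /P3; rewrite ltNge ltW// mulrC -ltr_pdivrMr.
Qed.

(** Equality case for [y] strictly between [x] and [z]. All three thresholds are
    expressed with vectors of the plane spanned by [homog x] and [homog z]. *)
Lemma cut_mul_between {R : realType} {n : nat} (Om : set 'rV[R]_n)
    (x z : 'rV[R]_n) (t m1 m2 m3 : R) :
  let y := x + t *: (z - x) in
  0 < t < 1 -> 0 < m3 -> m2 <= 1 ->
  (forall mu, homog_cone Om (homog y - mu *: homog x) <-> mu < m1) ->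
  (forall mu, homog_cone Om (homog z - mu *: homog y) <-> mu < m2) ->
  (forall mu, homog_cone Om (homog z - mu *: homog x) <-> mu < m3) ->
  m3 = m1 * m2.
Proof.
move=> y /andP[t0 t1] m30 m2_le1 P1 P2 P3.
have yE : homog y = (1 - t) *: homog x + t *: homog z by rewrite homog_line.
have m1E : m1 = 1 - t + t * m3.
  apply: lt_cut_inj => mu.
  have E : homog y - mu *: homog x =
      t *: (homog z - ((mu - (1 - t)) / t) *: homog x).
    by rewrite yE; apply/rowP => i; rewrite !mxE; field; rewrite gt_eqF.
  rewrite -P1 E homog_cone_scale// P3 ltr_pdivrMr// ltrBlDl.
  by rewrite [m3 * t]mulrC.
have m10 : 0 < m1 by rewrite m1E addr_gt0 ?subr_gt0// mulr_gt0.
have m3_le1 : m3 <= 1.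
  rewrite leNgt; apply/negP => m31.
  by have /homog_cone_subP[] := (P3 1).2 m31; rewrite ltxx.
suff -> : m2 = m3 / m1 by rewrite mulrCA mulfV ?mulr1// gt_eqF.
have m31_le1 : m3 / m1 <= 1.
  rewrite ler_pdivrMr// mul1r m1E.
  have : 0 <= (1 - t) * (1 - m3) by apply: mulr_ge0; lra.
  nra.
apply: lt_cut_inj => mu.
have [mu1|mu1] := leP 1 mu.
  by split; rewrite ltNge (le_trans _ mu1).
have k0 : 0 < 1 - mu * t by rewrite subr_gt0; nra.
have E : homog z - mu *: homog y =
    (1 - mu * t) *: (homog z - (mu * (1 - t) / (1 - mu * t)) *: homog x).
  by rewrite yE; apply/rowP => i; rewrite !mxE; field; rewrite gt_eqF.
rewrite -P2 E homog_cone_scale// P3 ltr_pdivrMr// ltr_pdivlMr// m1E.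
by split; nra.
Qed.

(** If [Om] contains the whole line, no boundary point is met and [m = 1]. *)
Lemma cut_eq1 {R : realType} {n : nat} (Om : set 'rV[R]_n) (x y : 'rV[R]_n)
    (m : R) :
  line x y `<=` Om ->
  (forall mu, homog_cone Om (homog y - mu *: homog x) <-> mu < m) -> m = 1.
Proof.
move=> lOm P; apply: lt_cut_inj => mu; rewrite -P homog_cone_subP.
split=> [[]//|mu1]; split=> //.
by apply: lOm; exists (1 - mu)^-1.
Qed.

Lemma line_sub {R : realType} {n : nat} (x z p q : 'rV[R]_n) :
  line x z p -> line x z q -> line p q `<=` line x z.
Proof.
move=> [s _ <-] [t _ <-] _ [u _ <-]; exists (s + u * (t - s)) => //.
by apply/rowP => i; rewrite !mxE; ring.
Qed.

(** * The triangle inequality and its equality case *)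

Theorem theorem7p1 (R : realType) (n : nat) (Om : set 'rV[R]_n)
    (hOm : proper_convex_domain Om) (x y z : 'rV[R]_n)
    (hx : Om x) (hy : Om y) (hz : Om z) :
  funk Om x y + funk Om y z >= funk Om x z /\
  (x <> y -> y <> z -> x <> z ->
   (* When x, y, z are collinear the three points are always aligned, whereas
      equality fails if y is not between x and z, unless Om contains the line. *)
   (line x z y -> segment x z y \/ line x z `<=` Om) ->
   (funk Om x y + funk Om y z = funk Om x z <->
    aligned (funk_point Om x y) (funk_point Om y z) (funk_point Om x z))).
Proof.
have cOm : @convex_set R 'rV[R]_n Om by case: hOm.
have [m1 [m10 _ -> P1 a1]] := funkP Om x y hOm hx hy.
have [m2 [m20 m21 -> P2 a2]] := funkP Om y z hOm hy hz.
have [m3 [m30 _ -> P3 a3]] := funkP Om x z hOm hx hz.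
have m120 : 0 < m1 * m2 by exact: mulr_gt0.
rewrite -opprD -lnM ?posrE//; split.
  rewrite lerN2 ler_ln ?posrE//.
  exact: cut_super_mul cOm m10 m20 m30 P1 P2 P3.
move=> /eqP xy /eqP yz /eqP xz between.
have [{}a1 {}a2 {}a3] := And3 (a1 xy) (a2 yz) (a3 xz).
have lnE : - ln (m1 * m2) = - ln m3 <-> m3 = m1 * m2.
  by split=> [/oppr_inj/ln_inj ->|->]; rewrite ?posrE.
rewrite lnE; split=> [m3E|al]; first exact: aligned_of_mul xy m3E a1 a2 a3.
have [lxzy|nl] := pselect (line x z y); last first.
  exact: mul_of_aligned xz nl a1 a2 a3 al.
have [[t /= /andP[t0 t1] yE]|lOm] := between lxzy.
  rewrite -yE in P1 P2.
  apply: cut_mul_between m30 m21 P1 P2 P3; rewrite !lt_neqAle t0 t1 !andbT eq_sym.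
  apply/andP; split.
    by apply: contra_neq xy => tE; rewrite -yE tE scale0r addr0.
  by apply: contra_neq yz => tE; rewrite -yE tE scale1r addrC subrK.
have lx : line x z x by exists 0; rewrite // scale0r addr0.
have lz : line x z z by exists 1; rewrite // scale1r addrC subrK.
rewrite (cut_eq1 _ _ _ _ lOm P3).
rewrite (cut_eq1 _ _ _ _ (subset_trans (line_sub _ _ _ _ lx lxzy) lOm) P1).
by rewrite (cut_eq1 _ _ _ _ (subset_trans (line_sub _ _ _ _ lxzy lz) lOm) P2) mulr1.
Qed.
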